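(* Let $\alpha$ and $m$ be natural numbers with $3\le\alpha$, $1\le m$ and $2m<\alpha$. Then $\mathcal{O}_m^{\alpha+m}\not\geq_{\mathrm{lo}}\mathcal{O}_m^{\alpha}$. (Hence $\mathcal{O}_m^{\alpha+m}<_{\mathrm{lo}}\mathcal{O}_m^{\alpha}$.)
   Context: Write $e(n)$ for the (possibly undefined) value at $n$ of the $e$-th partial recursive function, and $\langle\cdot,\cdot\rangle$ for a fixed recursive bijective pairing on $\mathbb{N}$. $\mathcal P(X)$ is the power set. For $A,B\subseteq\mathbb{N}$ put $A\Rightarrow B=\{e : \text{for all } a\in A,\ e(a)\text{ is defined and } e(a)\in B\}$ and $A\wedge B=\{\langle a,b\rangle : a\in A, b\in B\}$. For $h,k:\mathcal P(\mathbb N)\to\mathcal P(\mathbb N)$ write $h\le k$ if $\bigcap_{p\subseteq\mathbb N}(h(p)\Rightarrow k(p))\ne\emptyset$. A local operator (Lawvere–Tierney topology) on the effective topos $\mathbf{Eff}$ is represented by a function $j:\mathcal P(\mathbb N)\to\mathcal P(\mathbb N)$ such that $\bigcap_p(p\Rightarrow j(p))$, $\bigcap_{p,q}(j(p\Rightarrow q)\Rightarrow(j(p)\Rightarrow j(q)))$ and $\bigcap_p(j(j(p))\Rightarrow j(p))$ are non-empty; $j,k$ represent the same local operator iff $j\le k$ and $k\le j$, and local operators are ordered by $\le$ (subtoposes of $\mathbf{Eff}$ correspond order-reversingly to local operators). For $\theta:\mathbb N\to\mathcal P(\mathcal P(\mathbb N))$ put $\mathrm{mo}_\theta(p)=\{\langle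 n,e\rangle : \exists A\in\theta(n),\ e\in(A\Rightarrow p)\}$, and let $\mathrm{lo}_\theta$ be the least local operator $j$ with $\mathrm{mo}_\theta\le j$; it is represented by $\mathrm{lo}_\theta(p)=\bigcap_{q\subseteq\mathbb N}\big(((\mathrm{mo}_\theta(q)\Rightarrow q)\wedge(p\Rightarrow q))\Rightarrow q\big)$. Write $\eta\le_{\mathrm{lo}}\theta$ (equivalently $\theta\ge_{\mathrm{lo}}\eta$) if $\mathrm{lo}_\eta\le\mathrm{lo}_\theta$, and $\eta<_{\mathrm{lo}}\theta$ if $\eta\le_{\mathrm{lo}}\theta$ but not $\theta\le_{\mathrm{lo}}\eta$. A collection $\mathcal A\in\mathcal P(\mathcal P(\mathbb N))$ is identified with the constant function $\mathbb N\to\mathcal P(\mathcal P(\mathbb N))$ with value $\mathcal A$, so $\mathrm{lo}_{\mathcal A}$ and $\le_{\mathrm{lo}}$ make sense for collections. For $1<2m<\alpha\le\omega$, $\mathcal O_m^\alpha$ is the collection of all subsets of $\alpha=\{n\in\mathbb N: n<\alpha\}$ whose complement in $\alpha$ has exactly $m$ elements. *)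

(* Defs.v *)
From Stdlib Require Cantor.
From mathcomp Require Import all_boot zify.
From mathcomp Require Import classical_sets functions cardinality.

Set Implicit Arguments.
Unset Strict Implicit.
Unset Printing Implicit Defensive.

Local Open Scope classical_set_scope.
Local Open Scope card_scope.

Definition npair (a b : nat) : nat := Cantor.to_nat (a, b).

Lemma npair_inj (a b c d : nat) : npair a b = npair c d -> a = c /\ b = d.
Proof. by move=> /(f_equal Cantor.of_nat); rewrite !Cantor.cancel_of_to => -[]. Qed.

Lemma npair_surj (n : nat) : exists a b, n = npair a b.
Proof.
by exists (Cantor.of_nat n).1, (Cantor.of_nat n).2;
  rewrite /npair -surjective_pairing Cantor.cancel_to_of.
Qed.

Lemma leq_npair (a b : nat) : a + b <= npair a b.
Proof. by have := Cantor.to_nat_non_decreasing a b; rewrite /npair; lia. Qed.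

(* Unary partial recursive functions, generated by zero, successor, the two
   projections of [npair], pairing, composition, primitive recursion and
   unbounded minimisation; several arguments are passed through [npair]. *)
Inductive code : Type :=
| Zero
| Succ
| Fst
| Snd
| Pair of code & code
| Comp of code & code
| Prec of code & code
| Mu of code.

Inductive eval : code -> nat -> nat -> Prop :=
| eval_zero x : eval Zero x 0
| eval_succ x : eval Succ x x.+1
| eval_fst a b : eval Fst (npair a b) a
| eval_snd a b : eval Snd (npair a b) b
| eval_pair f g x y z : eval f x y -> eval g x z ->
    eval (Pair f g) x (npair y z)
| eval_comp f g x y z : eval g x y -> eval f y z -> eval (Comp f g) x z
| eval_prec0 f g a y : eval f a y -> eval (Prec f g) (npair a 0) y
| eval_precS f g a n y z : eval (Prec f g) (npair a n) y ->
    eval g (npair a (npair n y)) z -> eval (Prec f g) (npair a n.+1) z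
| eval_mu f a n : eval f (npair a n) 0 ->
    (forall k, k < n -> exists y, eval f (npair a k) y.+1) ->
    eval (Mu f) a n.

Lemma eval_inv (c : code) (x y : nat) : eval c x y ->
  match c with
  | Zero => y = 0
  | Succ => y = x.+1
  | Fst => exists b, x = npair y b
  | Snd => exists a, x = npair a y
  | Pair f g => exists u v, [/\ eval f x u, eval g x v & y = npair u v]
  | Comp f g => exists2 u, eval g x u & eval f u y
  | Prec f g => exists a n, x = npair a n /\
      match n with
      | 0 => eval f a y
      | k.+1 => exists2 u, eval (Prec f g) (npair a k) u &
                           eval g (npair a (npair k u)) y
      end
  | Mu f => eval f (npair x y) 0 /\
      forall k, k < y -> exists u, eval f (npair x k) u.+1
  end.
Proof.
case=> //.
- by move=> a b; exists b.
- by move=> a b; exists a.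
- by move=> f g a u v Hu Hv; exists u, v.
- by move=> f g a u v Hu Hv; exists u.
- by move=> f g a v Hv; exists a, 0.
- by move=> f g a n u v Hu Hv; exists a, n.+1; split=> //; exists u.
Qed.

Lemma eval_fun (c : code) (x y z : nat) : eval c x y -> eval c x z -> y = z.
Proof.
elim: c x y z => [||||f IHf g IHg|f IHf g IHg|f IHf g IHg|f IHf] x y z.
- by move=> /eval_inv-> /eval_inv->.
- by move=> /eval_inv-> /eval_inv->.
- by move=> /eval_inv[b ->] /eval_inv[d /npair_inj[]].
- by move=> /eval_inv[b ->] /eval_inv[d /npair_inj[]].
- move=> /eval_inv[u [v [Hu Hv ->]]] /eval_inv[u' [v' [Hu' Hv' ->]]].
  by rewrite (IHf _ _ _ Hu Hu') (IHg _ _ _ Hv Hv').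
- move=> /eval_inv[u Hu Hy] /eval_inv[v Hv].
  by rewrite -(IHg _ _ _ Hu Hv); exact: IHf Hy.
- have [a [n ->]] := npair_surj x.
  elim: n y z => [|n IHn] y z.
    move=> /eval_inv[_ [_ [/npair_inj[<- <-] Hy]]].
    by move=> /eval_inv[_ [_ [/npair_inj[<- <-] Hz]]]; exact: IHf Hy Hz.
  move=> /eval_inv[_ [_ [/npair_inj[<- <-] [u Hu Hy]]]].
  move=> /eval_inv[_ [_ [/npair_inj[<- <-] [v Hv]]]].
  by rewrite -(IHn _ _ Hu Hv); exact: IHg Hy.
- move=> /eval_inv[Hn Ln] /eval_inv[Hk Lk].
  have [/Lk [u Hu]|/Ln [u Hu]|//] := ltngtP y z.
  + by have := IHf _ _ _ Hn Hu.
  + by have := IHf _ _ _ Hk Hu.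
Qed.

Fixpoint encode (c : code) : nat :=
  match c with
  | Zero => 0
  | Succ => 1
  | Fst => 2
  | Snd => 3
  | Pair f g => 4 * npair (encode f) (encode g) + 4
  | Comp f g => 4 * npair (encode f) (encode g) + 5
  | Prec f g => 4 * npair (encode f) (encode g) + 6
  | Mu f => 4 * encode f + 7
  end.

Lemma encode_inj : injective encode.
Proof.
by elim=> [||||f IHf g IHg|f IHf g IHg|f IHf g IHg|f IHf] [||||f' g'|f' g'|f' g'|f']
  //= E; try lia; try (have /npair_inj[/IHf-> /IHg->//] :
    npair (encode f) (encode g) = npair (encode f') (encode g') by lia);
  congr Mu; apply: IHf; lia.
Qed.

Lemma encode_surj (e : nat) : exists c, encode c = e.
Proof.
elim/ltn_ind: e => e IH.
have [|e4] := ltnP e 4.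
  by case: e IH => [|[|[|[|]]]] // _ _;
    [exists Zero | exists Succ | exists Fst | exists Snd].
have [q [r [Ee r4]]] : exists q r, e = 4 * q + 4 + r /\ r < 4.
  by exists ((e - 4) %/ 4), ((e - 4) %% 4); lia.
have [a [b Eq]] := npair_surj q; have := leq_npair a b; rewrite -Eq => ab.
have [|f Ef] := IH a; first lia.
have [|g Eg] := IH b; first lia.
have [|h Eh] := IH q; first lia.
case: r r4 Ee => [|[|[|[|]]]] // _ Ee.
- by exists (Pair f g); rewrite /= Ef Eg -Eq; lia.
- by exists (Comp f g); rewrite /= Ef Eg -Eq; lia.
- by exists (Prec f g); rewrite /= Ef Eg -Eq; lia.
- by exists (Mu h); rewrite /= Eh; lia.
Qed.

(* [phi e x y]: e(x) is defined and equal to y.  Since [encode] is a bijection,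
   every e is the index of exactly one code. *)
Definition phi (e x y : nat) : Prop := exists2 c, encode c = e & eval c x y.

Lemma phi_fun (e x y z : nat) : phi e x y -> phi e x z -> y = z.
Proof. by case=> c <- Hy [d /encode_inj -> Hz]; exact: eval_fun Hy Hz. Qed.

Definition imp_set (A B : set nat) : set nat :=
  [set e | forall a, A a -> exists2 b, phi e a b & B b].

Definition and_set (A B : set nat) : set nat :=
  [set x | exists a b, [/\ A a, B b & x = npair a b]].

(* h <= k: one index realizes all the implications h(p) => k(p) simultaneously. *)
Definition op_le (h k : set nat -> set nat) : Prop :=
  \bigcap_p imp_set (h p) (k p) !=set0.

Definition mo (theta : nat -> set (set nat)) (p : set nat) : set nat :=
  [set x | exists n e, x = npair n e /\ exists2 A, theta n A & imp_set A p e].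

(* Representing function of the least local operator j on the effective topos
   such that op_le (mo theta) j. *)
Definition lo (theta : nat -> set (set nat)) (p : set nat) : set nat :=
  \bigcap_q imp_set (and_set (imp_set (mo theta q) q) (imp_set p q)) q.

Definition lo_le (eta theta : nat -> set (set nat)) : Prop :=
  op_le (lo eta) (lo theta).

Definition lo_lt (eta theta : nat -> set (set nat)) : Prop :=
  lo_le eta theta /\ ~ lo_le theta eta.

Definition cO (m alpha : nat) : set (set nat) :=
  [set A | A `<=` `I_alpha /\ `I_alpha `\` A #= `I_m].

(* Main.v *)
Require Import Defs.
From Stdlib Require Cantor.
From mathcomp Require Import all_boot zify.
From mathcomp Require Import boolp classical_sets functions cardinality.

(** If every [d] members of [AA] have a common element, then so do every [d]
    members of a collection [BB] with [lo BB <= lo AA]: a realizer yields one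
    tree [t] which, for each [B] in [BB], has its leaves in [B] once every node is
    restricted to a suitable member of [AA]; given [B_0, ..., B_(d-1)], walking
    down [t] along common elements of the [d] members of [AA] met at each node
    ends in a leaf common to all the [B_i].
    Members of [cO m alpha] omit [m] points each, so every [d] of them meet iff
    [d * m < alpha].  For [d] the ceiling of [alpha / m] this fails for [alpha]
    and holds for [alpha + m]. *)

Set Implicit Arguments.
Unset Strict Implicit.
Unset Printing Implicit Defensive.

Local Open Scope classical_set_scope.

(** * Total recursive functions *)

Definition recursive (f : nat -> nat) : Prop :=
  exists c, forall x, eval c x (f x).

Definition nfst (x : nat) : nat := (Cantor.of_nat x).1.
Definition nsnd (x : nat) : nat := (Cantor.of_nat x).2.

Lemma nfstE a b : nfst (npair a b) = a.
Proof. by rewrite /nfst /npair Cantor.cancel_of_to. Qed.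

Lemma nsndE a b : nsnd (npair a b) = b.
Proof. by rewrite /nsnd /npair Cantor.cancel_of_to. Qed.

Lemma npairE x : npair (nfst x) (nsnd x) = x.
Proof. by have [a [b ->]] := npair_surj x; rewrite nfstE nsndE. Qed.

(** Case analysis packaged as a function, so that [recursiveness] can recognise it syntactically. *)
Definition ncase (n a : nat) (g : nat -> nat) : nat :=
  if n is k.+1 then g k else a.

Lemma eval_id x : eval (Pair Fst Snd) x x.
Proof.
have [a [b ->]] := npair_surj x.
by apply: eval_pair; [exact: eval_fst | exact: eval_snd].
Qed.

Lemma recursive_id : recursive (fun x => x).
Proof. by exists (Pair Fst Snd); exact: eval_id. Qed.

Lemma recursive_comp f g :
  recursive f -> recursive g -> recursive (fun x => f (g x)).
Proof.
by move=> [c cP] [d dP]; exists (Comp c d) => x; apply: eval_comp (dP x) (cP _).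
Qed.

Lemma recursive_succ f : recursive f -> recursive (fun x => (f x).+1).
Proof. by apply: recursive_comp; exists Succ; exact: eval_succ. Qed.

Lemma recursive_const n : recursive (fun=> n).
Proof.
elim: n => [|n]; last exact: recursive_succ.
by exists Zero; exact: eval_zero.
Qed.

Lemma recursive_nfst f : recursive f -> recursive (fun x => nfst (f x)).
Proof.
apply: recursive_comp; exists Fst => x.
by rewrite -{1}(npairE x); exact: eval_fst.
Qed.

Lemma recursive_nsnd f : recursive f -> recursive (fun x => nsnd (f x)).
Proof.
apply: recursive_comp; exists Snd => x.
by rewrite -{1}(npairE x); exact: eval_snd.
Qed.

Lemma recursive_npair f g :
  recursive f -> recursive g -> recursive (fun x => npair (f x) (g x)).
Proof.
by move=> [c cP] [d dP]; exists (Pair c d) => x; apply: eval_pair.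
Qed.

Lemma recursive_ncase f h (g : nat -> nat -> nat) :
  recursive f -> recursive h -> recursive (fun z => g (nfst z) (nsnd z)) ->
  recursive (fun x => ncase (f x) (h x) (g x)).
Proof.
move=> [cf fP] [ch hP] [cg gP].
(* Primitive recursion whose step discards the recursive value. *)
exists (Comp (Prec ch (Comp cg (Pair Fst (Comp Fst Snd))))
             (Pair (Pair Fst Snd) cf)) => x.
apply: eval_comp (eval_pair (eval_id x) (fP x)) _.
elim: (f x) => [|n IH]; first exact: eval_prec0.
apply: eval_precS IH _.
apply: (@eval_comp _ _ _ (npair x n)); last first.
  by have := gP (npair x n); rewrite nfstE nsndE.
apply: eval_pair; first exact: eval_fst.
by apply: eval_comp; [exact: eval_snd | exact: eval_fst].
Qed.

Lemma recursive_iter f g h : recursive f -> recursive g -> recursive h ->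
  recursive (fun x => iter (g x) f (h x)).
Proof.
move=> [cf fP] [cg gP] [ch hP].
exists (Comp (Prec (Pair Fst Snd) (Comp cf (Comp Snd Snd))) (Pair ch cg)) => x.
apply: eval_comp (eval_pair (hP x) (gP x)) _.
elim: (g x) => [|n IH]; first exact: (eval_prec0 _ (eval_id _)).
apply: eval_precS IH _; apply: eval_comp (fP _).
by apply: eval_comp; exact: eval_snd.
Qed.

(** [encode] keeps the constructor in the residue modulo 4. Residue and quotient are found by
    counting up with carry, which needs only iteration and case analysis. *)
Definition divmod4_step (d : nat) : nat :=
  let next := npair (nfst d).+1 (nsnd d) in
  ncase (nfst d) next (fun r => ncase r next (fun r => ncase r next
    (fun=> npair 0 (nsnd d).+1))).

Definition divmod4 (n : nat) : nat := iter n divmod4_step (npair 0 0).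

Lemma divmod4E q r : r < 4 -> divmod4 (4 * q + r) = npair r q.
Proof.
move=> r4; suff E n : divmod4 n = npair (n %% 4) (n %/ 4).
  by rewrite E; congr npair; lia.
elim: n => [//|n IH]; rewrite /divmod4 iterS -/(divmod4 n) IH.
rewrite /divmod4_step nfstE nsndE.
have : n %% 4 < 4 by lia.
case E : (n %% 4) => [|[|[|[|]]]] //= _; congr npair; lia.
Qed.

Ltac recursiveness :=
  cbv beta zeta;
  lazymatch goal with
  | |- recursive (fun x => x) => exact: recursive_id
  | |- recursive nfst => exact: (recursive_nfst recursive_id)
  | |- recursive nsnd => exact: (recursive_nsnd recursive_id)
  | |- recursive (fun x => ncase _ _ _) => apply: recursive_ncase; recursiveness
  | |- recursive (fun x => npair _ _) => apply: recursive_npair; recursiveness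
  | |- recursive (fun x => nfst _) => apply: recursive_nfst; recursiveness
  | |- recursive (fun x => nsnd _) => apply: recursive_nsnd; recursiveness
  | |- recursive (fun x => iter _ _ _) => apply: recursive_iter; recursiveness
  | |- recursive (fun x => S _) => first
      [exact: recursive_const | apply: recursive_succ; recursiveness]
  | |- recursive (fun x => 0) => exact: recursive_const
  | |- _ => try assumption
  end.

Lemma recursive_divmod4 f : recursive f -> recursive (fun x => divmod4 (f x)).
Proof.
apply: recursive_comp; rewrite /divmod4.
have stepP : recursive divmod4_step by rewrite /divmod4_step; recursiveness.
by recursiveness.
Qed.

(** * A universal code *)

(* The state [npair k x] of the machine is a current value [x] and a stack [k] of
   instructions, with [0] for the empty stack.  [ieval c] applies [c] to [x];
   [ipairL g y] turns [x] into [npair x (g y)], [ipairR y] turns it into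
   [npair y x]; [imu f a n] tests [x], the value of [f] at [npair a n]. *)
Definition push (i k : nat) : nat := (npair i k).+1.
Definition ieval (e : nat) : nat := npair 0 e.
Definition ipairL (g y : nat) : nat := npair 1 (npair g y).
Definition ipairR (y : nat) : nat := npair 2 y.
Definition imu (f a n : nat) : nat := npair 3 (npair f (npair a n)).

Definition enter_mu (f a n k : nat) : nat :=
  npair (push (ieval f) (push (imu f a n) k)) (npair a n).

(** Atomic codes have quotient 0; otherwise the predecessor [q] of the quotient holds the subcodes.
    For [Prec], the two [ipairR] rebuild the argument of the step code around the recursive
    value. *)
Definition step_eval (e k x : nat) : nat :=
  ncase (nsnd (divmod4 e))
    (ncase (nfst (divmod4 e)) (npair k 0)
      (fun r => ncase r (npair k x.+1)
      (fun r => ncase r (npair k (nfst x))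
      (fun=> npair k (nsnd x)))))
    (fun q => ncase (nfst (divmod4 e))
      (npair (push (ieval (nfst q)) (push (ipairL (nsnd q) x) k)) x)
      (fun r => ncase r
        (npair (push (ieval (nsnd q)) (push (ieval (nfst q)) k)) x)
      (fun r => ncase r
        (ncase (nsnd x) (npair (push (ieval (nfst q)) k) (nfst x))
          (fun n => npair (push (ieval e) (push (ipairR n)
            (push (ipairR (nfst x)) (push (ieval (nsnd q)) k))))
            (npair (nfst x) n)))
      (fun=> enter_mu q x 0 k)))).

Definition step_instr (t d k x : nat) : nat :=
  ncase t (step_eval d k x)
  (fun t => ncase t
    (npair (push (ieval (nfst d)) (push (ipairR x) k)) (nsnd d))
  (fun t => ncase t (npair k (npair d x))
  (fun=> ncase x (npair k (nsnd (nsnd d)))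
    (fun=> enter_mu (nfst d) (nfst (nsnd d)) (nsnd (nsnd d)).+1 k)))).

(** States with an empty stack are fixed points, so running past the halting time is harmless. *)
Definition step (s : nat) : nat :=
  ncase (nfst s) s
    (fun k => step_instr (nfst (nfst k)) (nsnd (nfst k)) (nsnd k) (nsnd s)).

Lemma recursive_step : recursive step.
Proof.
rewrite /step /step_instr /step_eval /enter_mu /push /ieval /ipairL /ipairR /imu.
by recursiveness; apply: recursive_divmod4; recursiveness.
Qed.

Definition reach (s t : nat) : Prop := exists n, iter n step s = t.

Lemma reach_trans s t u : reach s t -> reach t u -> reach s u.
Proof. by move=> [n <-] [k <-]; exists (k + n); rewrite iterD. Qed.

Lemma reach_step s t : reach (step s) t -> reach s t.
Proof. by move=> [n <-]; exists n.+1; rewrite iterSr. Qed.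

Lemma reach_refl s : reach s s.
Proof. by exists 0. Qed.

Lemma step_push t d k x :
  step (npair (push (npair t d) k) x) = step_instr t d k x.
Proof. by rewrite /step !(nfstE, nsndE) /= !(nfstE, nsndE). Qed.

(** The stack [k] is arbitrary so that the induction hypotheses apply on top of pending
    instructions. *)
Lemma reach_eval c x y : eval c x y ->
  forall k, reach (npair (push (ieval (encode c)) k) x) (npair k y).
Proof.
have enc n r : r < 4 -> divmod4 (4 * n + (r + 4)) = npair r n.+1.
  by move=> r4; rewrite -divmod4E //; congr divmod4; lia.
elim: c x y => [||||f IHf g IHg|f IHf g IHg|f IHf g IHg|f IHf] x y.
- move=> /eval_inv-> k; apply: reach_step.
  rewrite step_push /= /step_eval (divmod4E 0 (r := 0)) // !(nfstE, nsndE).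
  exact: reach_refl.
- move=> /eval_inv-> k; apply: reach_step.
  rewrite step_push /= /step_eval (divmod4E 0 (r := 1)) // !(nfstE, nsndE).
  exact: reach_refl.
- move=> /eval_inv[b ->] k; apply: reach_step.
  rewrite step_push /= /step_eval (divmod4E 0 (r := 2)) // !(nfstE, nsndE).
  exact: reach_refl.
- move=> /eval_inv[b ->] k; apply: reach_step.
  rewrite step_push /= /step_eval (divmod4E 0 (r := 3)) // !(nfstE, nsndE).
  exact: reach_refl.
- move=> /eval_inv[u [v [Hu Hv ->]]] k; apply: reach_step.
  rewrite step_push /= /step_eval (enc _ 0) // !(nfstE, nsndE) /= !(nfstE, nsndE).
  apply: reach_trans (IHf _ _ Hu _) _; apply: reach_step.
  rewrite step_push /= !(nfstE, nsndE).
  apply: reach_trans (IHg _ _ Hv _) _; apply: reach_step.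
  by rewrite step_push; exact: reach_refl.
- move=> /eval_inv[u Hu Hy] k; apply: reach_step.
  rewrite step_push /= /step_eval (enc _ 1) // !(nfstE, nsndE) /= !(nfstE, nsndE).
  by apply: reach_trans (IHg _ _ Hu _) _; exact: IHf.
- have [a [n ->]] := npair_surj x.
  elim: n y => [|n IHn] y /eval_inv[_ [_ [/npair_inj[<- <-]]]].
    move=> Hy k; apply: reach_step.
    rewrite step_push /= /step_eval (enc _ 2) // !(nfstE, nsndE) /= !(nfstE, nsndE).
    exact: IHf.
  move=> [u Hu Hy] k; apply: reach_step.
  rewrite step_push /= /step_eval (enc _ 2) // !(nfstE, nsndE) /= !(nfstE, nsndE).
  apply: reach_trans (IHn _ Hu _) _.
  apply: reach_step; rewrite step_push /=.
  apply: reach_step; rewrite step_push /=.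
  exact: IHg.
- move=> /eval_inv[Hy Ly] k; apply: reach_step.
  rewrite step_push /= /step_eval (enc _ 3) // !(nfstE, nsndE) /=.
  (* Here [j] counts the failing tests left before the least zero [y]. *)
  suff loop j n : n + j = y -> reach (enter_mu (encode f) x n k) (npair k y).
    exact: (loop y).
  elim: j n => [|j IHj] n Ej; rewrite /enter_mu.
    rewrite addn0 in Ej; rewrite Ej; apply: reach_trans (IHf _ _ Hy _) _.
    apply: reach_step; rewrite step_push /= !(nfstE, nsndE); exact: reach_refl.
  have [|u Hu] := Ly n; first by lia.
  apply: reach_trans (IHf _ _ Hu _) _.
  apply: reach_step; rewrite step_push /= !(nfstE, nsndE); apply: IHj; lia.
Qed.

(** Minimisation finds the first step count at which the stack is empty; the output is then read off
    the state. This allows a realizer to apply an index that it receives as input. *)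
Lemma universal_code :
  exists u, forall c x y, eval c x y -> eval u (npair (encode c) x) y.
Proof.
pose run z := iter (nsnd z) step
  (npair (push (ieval (nfst (nfst z))) 0) (nsnd (nfst z))).
have [r rP] : recursive run.
  rewrite /run /push /ieval; have stepP := recursive_step; by recursiveness.
have [h hP] : recursive (fun z => nfst (run z)).
  by apply: recursive_nfst; exists r.
exists (Comp Snd (Comp r (Pair (Pair Fst Snd) (Mu h)))) => c x y /reach_eval Ec.
pose z := npair (encode c) x.
have [N EN] : exists N, run (npair z N) = npair 0 y.
  by have [N EN] := Ec 0; exists N; rewrite /run !(nfstE, nsndE).
have exN : exists n, nfst (run (npair z n)) == 0 by exists N; rewrite EN nfstE.
case: (ex_minnP exN) => n /eqP En minn.
(* The least halting time [n] may precede [N], but the state no longer changes in between. *)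
have {}EN : run (npair z n) = npair 0 y.
  have nN : n <= N by apply: minn; rewrite EN nfstE.
  rewrite -EN -(subnK nN) /run !(nfstE, nsndE) iterD.
  elim: (N - n) => [//|j]; rewrite iterS => <-.
  by move: En; rewrite /run /step !(nfstE, nsndE) => ->.
apply: eval_comp (eval_snd 0 y); rewrite -EN.
apply: eval_comp (rP _); apply: eval_pair; first exact: eval_id.
apply: eval_mu; first by rewrite -En; exact: hP.
move=> k kn; case E : (nfst (run (npair z k))) => [|v].
  by have := minn k; rewrite E eqxx leqNgt kn => /(_ isT).
by exists v; rewrite -E; exact: hP.
Qed.

(** * Finite intersection properties and local operators *)

Definition meets (d : nat) (AA : set (set nat)) : Prop :=
  forall A : nat -> set nat, (forall i, i < d -> AA (A i)) ->
  exists a, forall i, i < d -> A i a.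

(** The least set containing [B], tagged 0, and closed under the elements of [mo], tagged 1. One
    number can be a tree for several [B], through different choices of [A] at its nodes. Definedness
    and membership are separate premises so that induction gives a hypothesis for each child. *)
Inductive tree (AA : set (set nat)) (B : set nat) : nat -> Prop :=
| tree_leaf b : B b -> tree AA B (npair 0 b)
| tree_node e A : AA A -> (forall a, A a -> exists b, phi e a b) ->
    (forall a b, A a -> phi e a b -> tree AA B b) -> tree AA B (npair 1 e).

Lemma tree_leaf_inv AA B b : tree AA B (npair 0 b) -> B b.
Proof.
move=> H; inversion H as [b' Bb E|e A _ _ _ E].
  by case: (npair_inj E) => _ <-.
by case: (npair_inj E).
Qed.

Lemma tree_node_inv AA B e : tree AA B (npair 1 e) -> exists A,
  AA A /\ forall a b, A a -> phi e a b -> tree AA B b.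
Proof.
move=> H; inversion H as [b Bb E|e' A AAA _ next E].
  by case: (npair_inj E).
by exists A; case: (npair_inj E) => _ <-.
Qed.

(** Induction on the derivation for [B 0], which the successor [d.+1] guarantees to exist; the other
    derivations are only inverted along the way. *)
Lemma common_leaf d AA (B : nat -> set nat) t : meets d.+1 AA ->
  (forall i, i < d.+1 -> tree AA (B i) t) ->
  exists b, forall i, i < d.+1 -> B i b.
Proof.
move=> AAd treet; have := treet 0 isT.
move E : (B 0) => B0 tree0; elim: tree0 treet.
  by move=> b _ treet; exists b => i /treet/tree_leaf_inv.
move=> e A AAA def next IH treet.
have /choice[F FP] : forall i, exists A, i < d.+1 ->
    AA A /\ forall a b, A a -> phi e a b -> tree AA (B i) b.
  move=> i; have [id|_] := boolP (i < d.+1); last by exists set0.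
  by have [A' A'P] := tree_node_inv (treet i id); exists A'.
(* Coordinate 0 keeps the [A] of the induction, so that [IH] applies at the common point [a]. *)
have [|a aP] := AAd (fun i => if i is 0 then A else F i).
  by case=> [//|i] /FP[].
have Aa : A a := aP 0 isT.
have [b ab] := def a Aa; apply: (IH a b Aa ab) => -[_|i id].
  by rewrite E; exact: next ab.
by have [_] := FP _ id; apply; [exact: aP id | exact: ab].
Qed.

Lemma phi_encode c x y : phi (encode c) x y <-> eval c x y.
Proof. by split=> [[d /encode_inj->]|cxy] //; exists c. Qed.

Lemma lo_le_mono eta theta :
  (forall n A, eta n A -> exists2 A', theta n A' & A' `<=` A) ->
  lo_le eta theta.
Proof.
move=> sub; exists (encode (Pair Fst Snd)) => p _ a lopa.
exists a; first by apply/phi_encode; exact: eval_id.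
move=> q _ _ [u [v [uP vP ->]]]; apply: lopa => //; exists u, v; split=> //.
move=> _ [n [e [-> [A etaA eP]]]]; have [A' thetaA' A'A] := sub _ _ etaA.
by apply: uP; exists n, e; split=> //; exists A' => // x /A'A /eP.
Qed.

(** Given [u] and [v] for a target [q], apply [u] to [npair 0 v]: the index [v] maps [B] into [q],
    hence lies over the member [B] of [BB]. The same [z] serves every [B], which later yields one
    common tree. *)
Lemma lo_member : exists z, forall (BB : set (set nat)) B,
  BB B -> lo (cst BB) B z.
Proof.
have [U UP] := universal_code.
exists (encode (Comp U (Pair Fst (Pair Zero Snd)))).
move=> BB B BBB q _ _ [u [v [uP vP ->]]].
have [|b [c <- cb] qb] := uP (npair 0 v); first by exists 0, v; split=> //; exists B.
exists b => //; apply/phi_encode; apply: eval_comp (UP _ _ _ cb).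
apply: eval_pair; first exact: eval_fst.
by apply: eval_pair; [exact: eval_zero | exact: eval_snd].
Qed.

Lemma lo_tree : exists u v, forall (AA : set (set nat)) B w,
  lo (cst AA) B w -> exists2 t, phi w (npair u v) t & tree AA B t.
Proof.
have [c1 c1P] := recursive_const 1.
pose u := encode (Pair c1 Snd); pose v := encode (Pair Zero (Pair Fst Snd)).
(* Instantiate the intersection defining [lo] at [q := tree AA B]; [u] and [v] merely attach tags,
   whatever [AA] and [B] are. *)
exists u, v => AA B w wP; apply: wP => //; exists u, v; split=> //.
  move=> _ [n [e [-> [A AAA eP]]]]; exists (npair 1 e).
    by apply/phi_encode; apply: eval_pair (c1P _) (eval_snd _ _).
  apply: (tree_node AAA) => [a /eP[b]|a b /eP[b' eab' ?] eab]; first by exists b.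
  by rewrite (phi_fun eab eab').
move=> b Bb; exists (npair 0 b); last exact: tree_leaf.
by apply/phi_encode; apply: eval_pair (eval_zero _) (eval_id _).
Qed.

Lemma lo_le_meets d AA BB : lo_le (cst BB) (cst AA) ->
  meets d.+1 AA -> meets d.+1 BB.
Proof.
move=> [x xP] AAd B BBB; have [z zP] := lo_member; have [u [v uvP]] := lo_tree.
have tP i : i < d.+1 -> exists w t,
    [/\ phi x z w, phi w (npair u v) t & tree AA (B i) t].
  move=> id; have [w xzw loBw] := xP (B i) I z (zP _ _ (BBB i id)).
  by have [t wt treet] := uvP _ _ _ loBw; exists w, t.
(* None of [x], [z], [u], [v] depends on [i], so by functionality of [phi] the tree for [B 0] is the
   tree for every [B i]. *)
have [w [t [xzw wt _]]] := tP 0 isT.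
apply: (common_leaf (t := t) AAd) => i /tP[w' [t' [xzw' wt']]].
by rewrite (phi_fun xzw' xzw) in wt' *; rewrite (phi_fun wt' wt).
Qed.

(** * Cofinite collections *)

Lemma cO_compl_seq m alpha s : uniq s -> size s = m -> {subset s <= gtn alpha} ->
  cO m alpha (`I_alpha `\` [set` s]).
Proof.
move=> us sm sa; split; first by move=> x [].
rewrite setDD; apply/card_esym/card_set_bijP; exists (nth 0 s); split.
- by move=> i /=; rewrite -sm => im; split; [apply: sa|]; exact: mem_nth.
- move=> i j; rewrite !inE /= -sm => im jm /eqP.
  by rewrite nth_uniq // => /eqP.
- move=> x [_ /= xs]; exists (index x s); last exact: nth_index.
  by rewrite /= -sm index_mem.
Qed.

Lemma cO_compl m alpha A : cO m alpha A ->
  exists2 s, size s = m & forall x, x < alpha -> ~ A x -> x \in s.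
Proof.
move=> [_ /card_esym/card_set_bijP[f [_ _ fsurj]]].
exists [seq f i | i <- iota 0 m]; first by rewrite size_map size_iota.
move=> x xa nAx; have [//|i im <-] := fsurj x.
by apply: map_f; rewrite mem_iota.
Qed.

Lemma cO_meets m alpha d : d * m < alpha -> meets d (cO m alpha).
Proof.
move=> dma A AP; apply: contrapT => none.
(* The concatenated complements would cover all [alpha] points with a list of length [d * m]. *)
suff [s sd sP] : exists2 s, size s = d * m &
    forall x i, x < alpha -> i < d -> ~ A i x -> x \in s.
  have : size (iota 0 alpha) <= size s.
    apply: uniq_leq_size (iota_uniq _ _) _ => x; rewrite mem_iota /= => xa.
    apply: contrapT => xs; apply: none; exists x => i id.
    by apply: contrapT => nAx; apply: xs; exact: sP nAx.
  by rewrite size_iota sd leqNgt dma.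
elim: d AP {dma none} => [|d IH] AP; first by exists [::].
have [s sd sP] := IH (fun i id => AP i (ltnW id)).
have [r rm rP] := cO_compl (AP d (ltnSn d)).
exists (r ++ s) => [|x i xa]; first by rewrite size_cat rm sd mulSn.
rewrite ltnS leq_eqVlt mem_cat => /predU1P[->|id] nAx; apply/orP.
  by left; exact: rP.
by right; exact: sP nAx.
Qed.

Lemma cO_not_meets m alpha d : 0 < alpha -> m <= alpha -> alpha <= d * m ->
  ~ meets d (cO m alpha).
Proof.
(* Consecutive blocks of length [m] cover [alpha]; [minn] shifts the last one back to stay inside. A
   point [a] lies in block [a %/ m]. *)
move=> a0 ma adm; pose s i := iota (minn (i * m) (alpha - m)) m.
move=> /(_ (fun i => `I_alpha `\` [set` s i]))[i id|a aP].
  apply: cO_compl_seq; rewrite ?iota_uniq ?size_iota // => x.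
  by rewrite mem_iota unfold_in /=; lia.
have [d0 m0] : 0 < d /\ 0 < m by apply/andP; rewrite -muln_gt0; lia.
have [aa _] := aP 0 d0; rewrite /= in aa.
have lo_bound := leq_divM a m; have hi_bound := ltn_ceil a m0.
have [|_] := aP (a %/ m); first by rewrite ltn_divLR //; lia.
by apply; rewrite /= /s mem_iota; move: hi_bound; rewrite mulSn; lia.
Qed.

Lemma cO_shrink m alpha beta A : m < alpha -> alpha <= beta -> cO m beta A ->
  exists2 A', cO m alpha A' & A' `<=` A.
Proof.
move=> ma ab /cO_compl[s sm sP].
pose out := [seq x <- iota 0 alpha | x \notin A].
(* [A] omits at most [m] points below [alpha]; all of them come first, padded with points of [A] to
   exactly [m]. *)
pose r := take m (out ++ [seq x <- iota 0 alpha | x \in A]).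
have outm : size out <= m.
  rewrite -sm; apply: uniq_leq_size; first exact/filter_uniq/iota_uniq.
  move=> x; rewrite mem_filter mem_iota => /andP[/negP nAx xa].
  by apply: sP => [|Ax]; [lia | apply: nAx; rewrite inE].
have perm : perm_eq (out ++ [seq x <- iota 0 alpha | x \in A]) (iota 0 alpha).
  by rewrite perm_catC; exact/permPl/perm_filterC.
exists (`I_alpha `\` [set` r]).
  apply: cO_compl_seq.
  - by rewrite take_uniq // (perm_uniq perm) iota_uniq.
  - by rewrite size_takel // (perm_size perm) size_iota ltnW.
  - by move=> x /mem_take; rewrite (perm_mem perm) mem_iota unfold_in.
move=> x [/= xa xr]; apply: contrapT => nAx; apply: xr.
rewrite /r take_cat ltnNge outm /= mem_cat mem_filter mem_iota xa andbT.
by apply/orP; left; rewrite andbT; apply/negP; rewrite inE.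
Qed.

(* [cst A] is the constant function with value the collection A. *)
Theorem mainTheorem1 (alpha m : nat) (halpha : 3 <= alpha) (hm : 1 <= m)
    (h2m : 2 * m < alpha) :
  ~ lo_le (cst (cO m alpha)) (cst (cO m (alpha + m))) /\
  lo_lt (cst (cO m (alpha + m))) (cst (cO m alpha)).
Proof.
suff H : ~ lo_le (cst (cO m alpha)) (cst (cO m (alpha + m))).
  split=> //; split=> //; apply: lo_le_mono => n A; apply: cO_shrink; lia.
(* With this choice [d.+1] is the ceiling of [alpha / m]. *)
pose d := alpha.-1 %/ m => /(@lo_le_meets d) H.
have dm : d * m < alpha by have := leq_divM alpha.-1 m; rewrite -/d; lia.
have am : alpha <= d.+1 * m by have := ltn_ceil alpha.-1 hm; rewrite -/d; lia.
apply: (@cO_not_meets m alpha d.+1) => //; [lia|lia|].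
by apply: H; apply: cO_meets; rewrite mulSn addnC ltn_add2r.
Qed.
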